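(* Let $T$ be a homogeneous tree of degree $q\ge 1$ with reference vertex $v_0$. There are uncountably many inversion formulas for the vertex-horospherical Radon transform $\mathcal R_V$ acting on finitely supported functions on $V$ that are radial around $v_0$; they are of the following form: there are uncountably many complex sequences $(d_n)_{n\in\mathbb Z}$ such that, for every finitely supported radial function $f$ on $V$, with $\phi_n=\mathcal R_Vf(\omega,n)$ (which does not depend on $\omega$), $$f(v_0)=\sum_{n=-\infty}^{\infty}d_n\,\phi_n .$$ (All these formulas agree on the image of $\mathcal R_V$.) Two different explicit choices of such sequences are $$d_n=\begin{cases}1&n=0,\\ 1-q& n>0\text{ even},\\ 0&\text{otherwise},\end{cases}\qquad\text{and}\qquad d_n=\begin{cases}1& n\le 0\text{ even},\\ 1-q-q^n& n>0\text{ even},\\ 0& n\text{ odd}.\end{cases}$$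
   Context: $T$ is a tree in which every vertex has exactly $q+1$ neighbours; $V$ is its set of vertices with graph distance $\operatorname{dist}$. $\Omega$ is the set of ends (equivalence classes of geodesic rays that eventually coincide); $[v_0,\omega)$ is the ray from $v_0$ in the class $\omega$. The horospherical index is $h(v,v_0,\omega)=\operatorname{dist}(v_0,w)-\operatorname{dist}(v,w)$ for any $w$ far enough along $[v_0,\omega)$, and $\mathbf h_n(\omega,v_0)=\{v\in V:h(v,v_0,\omega)=n\}$ is the vertex-horosphere tangent at $\omega$ of index $n\in\mathbb Z$. The vertex-horospherical Radon transform of a function $f$ on $V$ is $\mathcal R_Vf(\omega,n)=\sum_{v\in\mathbf h_n(\omega,v_0)}f(v)$. A function $f$ on $V$ is radial if $f(v)$ depends only on $\operatorname{dist}(v,v_0)$; in this case $\mathcal R_Vf(\omega,n)$ depends only on $n$. *)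

(* Defs.v *)
From HB Require Import structures.
From mathcomp Require Import all_boot all_order all_algebra.
From mathcomp Require Import finmap.
From mathcomp Require Import boolp classical_sets functions cardinality fsbigop.
From mathcomp Require Import reals.
From mathcomp.real_closed Require Import complex.

Set Implicit Arguments.
Unset Strict Implicit.
Unset Printing Implicit Defensive.

Import Order.TTheory GRing.Theory Num.Theory.
Local Open Scope classical_set_scope.
Local Open Scope ring_scope.

Definition connected_graph (V : choiceType) (adj : rel V) : Prop :=
  forall x y : V, exists p : seq V, path adj x p /\ last x p = y.

(* [ucycle adj c] holds for the empty sequence and for c = [:: x; y] with x, y
   adjacent; neither is a cycle of the graph. *)
Definition acyclic_graph (V : choiceType) (adj : rel V) : Prop :=
  forall c : seq V, ucycle adj c -> (size c <= 2)%N.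

Definition is_tree (V : choiceType) (adj : rel V) : Prop :=
  [/\ irreflexive adj, symmetric adj, connected_graph adj & acyclic_graph adj].

(* The parameter q is the number of neighbours minus one. *)
Definition homogeneous_tree (q : nat) (V : choiceType) (adj : rel V) : Prop :=
  is_tree adj /\ forall x : V, ([set y | adj x y] #= `I_q.+1)%card.

Definition walk_length (V : choiceType) (adj : rel V) (x y : V) : set nat :=
  [set n | exists p : seq V, [/\ path adj x p, last x p = y & size p = n]].

(* The default value 0 is only reached when x and y are not connected. *)
Definition dist (V : choiceType) (adj : rel V) (x y : V) : nat :=
  xget 0%N [set n | walk_length adj x y n /\
                    forall m, walk_length adj x y m -> (n <= m)%N].

Definition geodesic_ray (V : choiceType) (adj : rel V) (r : nat -> V) : Prop :=
  forall i j : nat, (i <= j)%N -> dist adj (r i) (r j) = (j - i)%N.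

Definition eventually_coincide (V : choiceType) (r s : nat -> V) : Prop :=
  exists m n : nat, forall k : nat, r (m + k)%N = s (n + k)%N.

Definition ends (V : choiceType) (adj : rel V) : set (set (nat -> V)) :=
  [set w | exists2 r, geodesic_ray adj r &
           w = [set s | geodesic_ray adj s /\ eventually_coincide r s]].

(* [v0, w): in a tree, every end contains exactly one ray issued from v0. *)
Definition ray_from (V : choiceType) (v0 : V) (w : set (nat -> V)) : nat -> V :=
  xget (fun=> v0) [set r | w r /\ r 0%N = v0].

(* In a connected graph the difference below is eventually constant along the
   ray, so the default value 0 is never used. *)
Definition horo_index (V : choiceType) (adj : rel V) (v v0 : V)
    (w : set (nat -> V)) : int :=
  xget 0 [set n : int | exists N : nat, forall k : nat, (N <= k)%N ->
    (dist adj v0 (ray_from v0 w k))%:Z - (dist adj v (ray_from v0 w k))%:Z = n].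

Definition horosphere (V : choiceType) (adj : rel V) (v0 : V)
    (w : set (nat -> V)) (n : int) : set V :=
  [set v | horo_index adj v v0 w = n].

Definition finitely_supported (C : fieldType) (I : choiceType) (f : I -> C) :
  Prop := finite_set [set x | f x != 0].

Definition radial (C : Type) (V : choiceType) (adj : rel V) (v0 : V)
    (f : V -> C) : Prop :=
  forall u v : V, dist adj u v0 = dist adj v v0 -> f u = f v.

Definition radonV (C : fieldType) (V : choiceType) (adj : rel V) (v0 : V)
    (f : V -> C) (w : set (nat -> V)) (n : int) : C :=
  \sum_(v \in horosphere adj v0 w n) f v.

(* Hence the finitely supported sum over all integers in [bilateral_sum] below
   is the genuine one when phi is a Radon transform. *)
Lemma radonV_finitely_supported (C : fieldType) (V : choiceType) (adj : rel V)
    (v0 : V) (f : V -> C) (w : set (nat -> V)) :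
  finitely_supported f -> finitely_supported (radonV adj v0 f w).
Proof.
move=> finf; apply: (@sub_finite_set _ _
  ((fun v => horo_index adj v v0 w) @` [set x | f x != 0])); last first.
  exact: finite_image.
move=> n /= Rn; apply: contrapT => nim; move/eqP: Rn; apply.
apply: fsbig1 => v hv; apply/eqP/negPn/negP => fv.
by apply: nim; exists v.
Qed.

Definition bilateral_sum (C : fieldType) (d phi : int -> C) : C :=
  \sum_(n \in [set: int]) d n * phi n.

Definition inversion_sequence (C : fieldType) (V : choiceType) (adj : rel V)
    (v0 : V) (d : int -> C) : Prop :=
  forall f : V -> C, finitely_supported f -> radial adj v0 f ->
  forall w, ends adj w -> f v0 = bilateral_sum d (radonV adj v0 f w).

Definition dseq1 (C : fieldType) (q : nat) (n : int) : C :=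
  if n == 0 then 1
  else if (0 < n) && (2 %| n)%Z then 1 - q%:R
  else 0.

Definition dseq2 (C : fieldType) (q : nat) (n : int) : C :=
  if (2 %| n)%Z then
    if n <= 0 then 1 else 1 - q%:R - q%:R ^ n
  else 0.

(* Main.v *)
(* In a tree the walks without backtracking are the geodesics. Fix the ray from
   v0 to an end. The vertices at distance m from v0 are the end points of the
   walks without backtracking of length m from v0; such a walk follows the ray
   up to its j-th vertex and then leaves it, so it ends at horospherical index
   2 j - m. Hence the sum of d (h v) over the sphere of radius m depends on d, q
   and m alone, and satisfies a two-index recursion along the ray. Closed forms
   of this recursion show that for both explicit sequences the sum is 1 for
   m = 0 and 0 for m > 0, which is the inversion formula. The affine
   combinations of the two sequences with real parameter are then inversion
   sequences too, and pairwise distinct. *)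
Require Import Defs.
From HB Require Import structures.
From mathcomp Require Import all_boot all_order all_algebra.
From mathcomp Require Import finmap zify ring.
From mathcomp Require Import boolp classical_sets functions cardinality fsbigop.
From mathcomp Require Import reals.
From mathcomp.real_closed Require Import complex.
From mathcomp Require Import ereal lebesgue_measure.

Import Order.TTheory GRing.Theory Num.Theory.
Local Open Scope classical_set_scope.
Local Open Scope ring_scope.
Local Open Scope complex_scope.

Set Implicit Arguments.
Unset Strict Implicit.
Unset Printing Implicit Defensive.

(** * Walks without backtracking and distances in a tree *)

Section ReducedWalks.
Variables (V : choiceType) (adj : rel V).

(* [a] is the vertex visited before [x]; since adj is irreflexive, taking
   a = x puts no constraint on the first step. *)
Fixpoint reduced (a x : V) (p : seq V) : bool :=
  if p is y :: p' then [&& adj x y, y != a & reduced x y p'] else true.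

Lemma reduced_path a x p : reduced a x p -> path adj x p.
Proof.
by elim: p a x => //= y p IH a x /and3P[-> _ /IH].
Qed.

Hypothesis treeT : is_tree adj.

Let adjxx : irreflexive adj. Proof. by case: treeT. Qed.
Let adjC : symmetric adj. Proof. by case: treeT. Qed.

Lemma adj_neq x y : adj x y -> x != y.
Proof. by apply: contraTneq => ->; rewrite adjxx. Qed.

Lemma reduced_free a x p : reduced a x p -> reduced x x p.
Proof.
by case: p => //= y p /and3P[xy _ ->]; rewrite xy eq_sym adj_neq.
Qed.

(** If [x] came back in [p], the walk up to that return would be a closed simple one. Acyclicity
    leaves only an immediate return after one step, which [reduced] forbids. *)
Lemma reduced_uniq a x p : reduced a x p -> uniq (x :: p).
Proof.
case: treeT => _ _ _ acyc.
elim: p a x => // y p IH a x; rewrite [reduced _ _ _]/= => /and3P[xy _ rp].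
have uyp := IH _ _ rp; rewrite cons_uniq uyp andbT inE negb_or adj_neq//=.
apply/negP => xp; case/splitPr: xp rp uyp => p1 p2 rp uyp.
suff: (size (x :: y :: p1) <= 2)%N.
  by case: p1 {uyp} rp => //=; rewrite eqxx /= andbF.
apply: acyc; rewrite /ucycle /= rcons_path xy /=; apply/andP; split.
  by have /= := reduced_path rp; rewrite cat_path /= => /and3P[-> ->].
move: uyp; rewrite -cat_cons cat_uniq.
by rewrite /= negb_or => /and3P[-> /andP[-> _] _].
Qed.

(** The walk [u] is [p] run backwards, then [b :: s]. The second hypothesis prevents backtracking at
    the junction [x]; for empty [p] the default of [head] leaves the step to [b] free. *)
Lemma reduced_rev_cat b x p s :
  reduced b x p -> reduced (head x p) x (b :: s) ->
  exists u, [/\ reduced (last x p) (last x p) u, last (last x p) u = last b s &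
                size u = (size p + size s).+1].
Proof.
elim: p b x s => [|y p IH] b x s /=.
  by move=> _ rs; exists (b :: s); rewrite /= rs.
move=> /and3P[xy yb rp] rs.
have [|u [ru lu su]] := IH x y (b :: s) rp.
  rewrite /= adjC xy rs andbT /=.
  by case: p rp {IH} => [|z p] /=; [rewrite adj_neq|case/and3P; rewrite eq_sym].
by exists u; rewrite ru lu su /= addnS.
Qed.

Lemma reduced_closed a x p : reduced a x p -> last x p = x -> p = [::].
Proof.
case/lastP: p => // p z /reduced_uniq; rewrite last_rcons => + zx.
by rewrite zx /= mem_rcons inE eqxx.
Qed.

(** After the common prefix, one walk reversed and followed by the other would be a nonempty closed
    reduced walk. *)
Lemma reduced_inj a x p b p' : reduced a x p -> reduced b x p' ->
  last x p = last x p' -> p = p'.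
Proof.
elim: p a b x p' => [|y p IH] a b x p'.
  by move=> _ rp' /esym /(reduced_closed rp').
case: p' => [|y' p'] rp rp'; first by move/(reduced_closed rp).
have [yy' /= ep|yy' ep] := eqVneq y y'.
  move: rp rp' => /= /and3P[_ _ rp] /and3P[_ _ rp']; rewrite -yy' in rp' ep *.
  by rewrite (IH _ _ _ _ rp rp' ep).
have [||u [ru lu su]] := @reduced_rev_cat y' x (y :: p) p'.
- by move: rp => /= /and3P[-> _ ->]; rewrite yy'.
- by move: rp' => /= /and3P[-> _ ->]; rewrite eq_sym yy'.
by move: su; rewrite (reduced_closed ru)// lu -[last y' p']/(last x (y' :: p')).
Qed.

(** Induction from the end of the walk: a new first step either extends the reduced tail or cancels
    against the first step of that tail. *)
Lemma walk_reduced x p : path adj x p ->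
  exists p', [/\ reduced x x p', last x p' = last x p & (size p' <= size p)%N].
Proof.
elim: p x => [|y p IH] x /=; first by exists [::].
move=> /andP[xy /IH[p' [rp' lp' sp']]].
case: p' => [|z p'] in rp' lp' sp' *.
  by exists [:: y]; rewrite /= xy eq_sym adj_neq.
have [zx|zx] := eqVneq z x.
  exists p'; move: rp' lp' sp' => /= /and3P[_ _ rp'] <- sp'.
  by rewrite -zx; split; [exact: reduced_free rp'| |lia].
exists (y :: z :: p'); move: rp' lp' sp' => /= /and3P[-> _ ->] -> sp'.
by rewrite zx xy eq_sym adj_neq.
Qed.

Lemma reduced_exists x y : exists2 p, reduced x x p & last x p = y.
Proof.
case: treeT => _ _ /(_ x y)[p [/walk_reduced[p' [rp' <- _]] <-]] _.
by exists p'.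
Qed.

Lemma dist_reduced a x p : reduced a x p -> dist adj x (last x p) = size p.
Proof.
move=> rp; have minp m : walk_length adj x (last x p) m -> (size p <= m)%N.
  move=> [p1 [/walk_reduced[p2 [rp2 lp2 sp2]] lp1 <-]].
  by rewrite (reduced_inj rp rp2)// lp2 lp1.
apply: xget_unique; first by split=> //; exists p; rewrite (reduced_path rp).
move=> n [wn /(_ (size p)) nle]; apply/eqP; rewrite eqn_leq minp// andbT.
by apply: nle; exists p; rewrite (reduced_path rp).
Qed.

Lemma dist_reduced_rev a x p : reduced a x p -> dist adj (last x p) x = size p.
Proof.
case: p => [_|y p /= /and3P[xy _ rp]]; first exact: (@dist_reduced x x [::]).
have [|u [ru lu su]] := @reduced_rev_cat x y p [::] rp.
  rewrite /= adjC xy andbT.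
  by case: p rp => [|z p] /=; [rewrite adj_neq|case/and3P; rewrite eq_sym].
by rewrite -[X in dist _ _ X]lu (dist_reduced ru) su addn0.
Qed.

Lemma dist1_adj x y : dist adj x y = 1%N -> adj x y.
Proof.
have [p rp <-] := reduced_exists x y; rewrite (dist_reduced rp).
by case: p rp => [|z []]//= /andP[].
Qed.

Lemma distxx x : dist adj x x = 0%N.
Proof. exact: (@dist_reduced x x [::]). Qed.

(** * Geodesic rays and the horospherical index *)

Definition ray_like (r : nat -> V) :=
  forall i, adj (r i) (r i.+1) /\ r i != r i.+2.

Lemma ray_reduced r a i n : ray_like r -> a != r i.+1 ->
  reduced a (r i) [seq r k | k <- iota i.+1 n].
Proof.
move=> rr; elim: n a i => //= n IH a i ai.
by have [-> ?] := rr i; rewrite eq_sym ai IH.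
Qed.

Lemma last_ray (r : nat -> V) i n :
  last (r i) [seq r k | k <- iota i.+1 n] = r (i + n)%N.
Proof. by elim: n i => [|n IH] i /=; rewrite ?addn0// IH addSnnS. Qed.

Lemma geodesic_rayP r : geodesic_ray adj r <-> ray_like r.
Proof.
split=> [gr i|rr i j ij].
  split; first by apply: dist1_adj; rewrite gr// subSnn.
  apply/eqP => e; have := gr i i.+2 (leqW (leqnSn i)).
  by rewrite -e distxx; lia.
have := @ray_reduced r (r i) i (j - i) rr (adj_neq (proj1 (rr i))).
by move/dist_reduced; rewrite last_ray size_map size_iota subnKC.
Qed.

(** The origin moves one edge at a time along a path from [r 0] to [x]: the ray loses its first
    vertex if it already passes through the new origin, and otherwise gains one. *)
Lemma ray_exists r x : geodesic_ray adj r ->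
  exists s, [/\ geodesic_ray adj s, eventually_coincide r s & s 0%N = x].
Proof.
move=> gr; case: treeT => _ _ /(_ x (r 0%N))[p [+ +]] _.
elim: p x => [|y p IH] x /=.
  by move=> _ ->; exists r; split=> //; exists 0%N, 0%N.
move=> /andP[xy yp] /(IH _ yp)[s [gs [m [n ers]] s0]].
have /geodesic_rayP rs := gs.
have [s1|s1] := eqVneq (s 1%N) x.
  exists (fun i => s i.+1); split=> //.
    by apply/geodesic_rayP => i; exact: rs.
  by exists m.+1, n => k; rewrite addSnnS ers addnS.
exists (fun i => if i is i'.+1 then s i' else x); split=> //.
  apply/geodesic_rayP => -[|i]; last exact: rs.
  by rewrite s0 xy eq_sym s1.
by exists m, n.+1 => k; rewrite ers.
Qed.

Lemma ray_fromP v0 w : ends adj w ->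
  ray_like (ray_from v0 w) /\ ray_from v0 w 0%N = v0.
Proof.
move=> [r gr wE].
have [s [gs ers s0]] := ray_exists v0 gr.
rewrite /ray_from.
have [|+ ->] := @xgetPex _ (fun=> v0) [set r | w r /\ r 0%N = v0].
  by exists s; rewrite wE.
by rewrite {1}wE => -[/geodesic_rayP].
Qed.

(** As [p] does not start towards [r j.+1], reversing it and then following the ray is a geodesic to
    [r k], of length [size p + (k - j)], while [v0] is at distance [k] from [r k]. *)
Lemma horo_index_branch v0 w j p (r := ray_from v0 w) : ends adj w ->
  reduced (r j.+1) (r j) p ->
  horo_index adj (last (r j) p) v0 w = j%:Z - (size p)%:Z.
Proof.
move=> wE rp; have [rr r0] := ray_fromP v0 wE.
rewrite /horo_index -/r in rr r0 *.
have dE k : (j.+1 <= k)%N ->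
    (dist adj v0 (r k))%:Z - (dist adj (last (r j) p) (r k))%:Z
      = j%:Z - (size p)%:Z.
  move=> jk.
  have /geodesic_rayP/(_ 0%N k (leq0n _)) := rr; rewrite r0 => ->.
  have [|u [ru lu su]] :=
      @reduced_rev_cat _ _ _ [seq r i | i <- iota j.+2 (k - j.+1)] rp.
    (* The segment from [r j] to [r k] needs its first vertex [r j.+1] split off, to match the shape
       [b :: s]. *)
    have := @ray_reduced r (head (r j) p) j (k - j) rr.
    have -> : (k - j = (k - j.+1).+1)%N by lia.
    apply; case: p rp => /= [_|y p /and3P[] //].
    exact: adj_neq (proj1 (rr j)).
  move: lu; rewrite last_ray subnKC// => <-.
  rewrite (dist_reduced ru) su size_map size_iota; lia.
apply: xget_unique; first by exists j.+1.
by move=> n [N nE]; rewrite -(nE (maxn N j.+1)) ?leq_maxl// dE// leq_maxr.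
Qed.

End ReducedWalks.

Lemma flatten_map_uniq (T : eqType) (U : eqType) (s : seq T) (t : T -> seq U) :
  uniq s -> {in s, forall x, uniq (t x)} ->
  {in s &, forall x y v, v \in t x -> v \in t y -> x = y} ->
  uniq (flatten [seq t x | x <- s]).
Proof.
elim: s => //= x s IH /andP[xs us] ut inj; rewrite cat_uniq ut ?mem_head//=.
rewrite IH//; last first.
- by move=> y z ys zs; apply: inj; rewrite inE (ys, zs) orbT.
- by move=> y ys; apply: ut; rewrite inE ys orbT.
rewrite andbT; apply/negP => /hasP[v /flattenP[_ /mapP[y ys ->] vy] vx].
have xy : x = y by apply: inj vx vy; rewrite ?mem_head// inE ys orbT.
by rewrite xy ys in xs.
Qed.

(** * Spheres as lists of end points of reduced walks *)

Section Spheres.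
Variables (V : choiceType) (adj : rel V) (q : nat).
Hypothesis homT : homogeneous_tree q adj.

Let treeT : is_tree adj. Proof. by case: homT. Qed.
Let adjxx : irreflexive adj. Proof. by case: treeT. Qed.
Let adjC : symmetric adj. Proof. by case: treeT. Qed.

Definition neighbours (x : V) : seq V := fset_set [set y | adj x y].

Lemma neighbours_uniq x : uniq (neighbours x).
Proof. exact: fset_uniq. Qed.

Lemma size_neighbours x : size (neighbours x) = q.+1.
Proof. by apply: card_fset_set; case: homT. Qed.

Lemma mem_neighbours x y : (y \in neighbours x) = adj x y.
Proof.
rewrite in_fset_set; first by apply/idP/idP; rewrite inE.
by apply/finite_setP; exists q.+1; case: homT.
Qed.

Lemma count_neighbours x a : adj x a -> count (predC1 a) (neighbours x) = q.
Proof.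
move=> xa; have := count_predC (pred1 a) (neighbours x).
rewrite size_neighbours count_uniq_mem ?neighbours_uniq//.
by rewrite mem_neighbours xa => -[].
Qed.

Lemma count_neighbours2 x a b : adj x a -> a != b ->
  count (predC1 b) [seq y <- neighbours x | y != a] = (q - adj x b)%N.
Proof.
move=> xa ab; set s := [seq y <- _ | _].
have <- : count_mem b s = adj x b.
  rewrite count_uniq_mem ?filter_uniq ?neighbours_uniq//.
  by rewrite mem_filter eq_sym ab mem_neighbours.
have -> : q = size s by rewrite size_filter (count_neighbours xa).
by rewrite -(count_predC (pred1 b)) addKn.
Qed.

(** For [a = x] this is the sphere of radius [l] around [x]; for [a] adjacent to [x] it is the part
    of that sphere not reached through [a]. *)
Fixpoint branch (l : nat) (a x : V) : seq V :=
  if l is l'.+1 then flatten [seq branch l' x y | y <- neighbours x & y != a]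
  else [:: x].

Lemma branchP l a x v :
  reflect (exists p, [/\ reduced adj a x p, size p = l & last x p = v])
          (v \in branch l a x).
Proof.
elim: l a x => [|l IH] a x /=.
  rewrite inE; apply: (iffP eqP) => [->|[p [_ /size0nil -> <-]]] //.
  by exists [::].
apply: (iffP flattenP) => [[_ /mapP[y + ->]] /IH[p [rp sp lp]]|].
  rewrite mem_filter mem_neighbours => /andP[ya xy].
  by exists (y :: p); rewrite /= xy ya rp sp lp.
move=> [[|y p] [//= /and3P[xy ya rp] [sp] lp]].
exists (branch l x y); last by apply/IH; exists p.
by apply/mapP; exists y; rewrite // mem_filter ya mem_neighbours.
Qed.

Lemma branch_uniq l a x : uniq (branch l a x).
Proof.
elim: l a x => //= l IH a x; apply: flatten_map_uniq => //.
  by rewrite filter_uniq// neighbours_uniq.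
move=> y z; rewrite !mem_filter !mem_neighbours => /andP[ya xy] /andP[za xz].
move=> v /branchP[p [rp _ <-]] /branchP[p' [rp' _ lp']].
have [] // : y :: p = z :: p'.
by apply: (@reduced_inj _ _ treeT a x _ a) => //=; apply/and3P; split.
Qed.

Lemma size_branch l a x : adj x a -> size (branch l a x) = (q ^ l)%N.
Proof.
elim: l a x => //= l IH a x xa; rewrite size_flatten /shape -map_comp.
rewrite sumnE big_map big_seq (eq_bigr (fun=> (q ^ l)%N)).
  rewrite -big_seq big_const_seq count_predT size_filter iter_addn_0.
  by rewrite (count_neighbours xa) mulnC expnS.
move=> y; rewrite mem_filter mem_neighbours => /andP[_ xy] /=.
by rewrite IH// adjC.
Qed.

(* A walk from the j-th vertex of a ray either goes on along the ray, or leaves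
   it for good, and then every step lowers the horospherical index by one. *)
Fixpoint horo_sum (C : fieldType) (d : int -> C) (j l : nat) : C :=
  if l is l'.+1 then
    horo_sum d j.+1 l' + ((q - (0 < j)) * q ^ l')%:R * d (j%:Z - l%:Z)
  else d j%:Z.

Variable v0 : V.

(** The step to [r j.+1] is the induction step; any other step opens a branch of [q ^ l] vertices,
    all of index [j - l.+1]. For [j = 0] the predecessor [r j.-1] is [v0] itself, so the whole
    sphere is covered. *)
Lemma sum_branch (C : fieldType) (d : int -> C) w j l (r := ray_from v0 w) :
  ends adj w ->
  \sum_(v <- branch l (r j.-1) (r j)) d (horo_index adj v v0 w)
    = horo_sum d j l.
Proof.
move=> we; have [rr r0] := ray_fromP treeT v0 we; rewrite -/r in rr r0.
elim: l j => [|l IH] j.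
  rewrite /= big_seq1 -[r j]/(last (r j) [::]).
  by rewrite (@horo_index_branch _ _ treeT) //= subr0.
rewrite [branch _ _ _]/= big_flatten big_map.
have rj1 : r j.+1 != r j.-1.
  case: j => [|j] /=; rewrite eq_sym; last by case: (rr j).
  by apply: (adj_neq treeT); case: (rr 0%N).
rewrite (bigD1_seq (r j.+1)) ?filter_uniq ?neighbours_uniq//=; last first.
  by rewrite mem_filter rj1 mem_neighbours; case: (rr j).
rewrite -[X in branch l X (r j.+1)]/(r j.+1.-1) IH; congr (_ + _).
have hE y : [&& y != r j.+1, y != r j.-1 & adj (r j) y] ->
    \sum_(v <- branch l (r j) y) d (horo_index adj v v0 w)
      = (q ^ l)%:R * d (j%:Z - l.+1%:Z).
  move=> /and3P[yj _ jy].
  rewrite (eq_big_seq (fun=> d (j%:Z - l.+1%:Z))).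
    rewrite big_const_seq count_predT iter_addr_0 size_branch 1?adjC//.
    by rewrite mulr_natl.
  move=> v /branchP[p [rp <- <-]].
  rewrite -[last y p]/(last (r j) (y :: p)) (@horo_index_branch _ _ treeT)//=.
  by rewrite jy yj rp.
rewrite big_seq_cond.
rewrite (eq_bigr (fun=> (q ^ l)%:R * d (j%:Z - l.+1%:Z))); last first.
  move=> y; rewrite mem_filter mem_neighbours andbC => /and3P[? ? ?].
  exact/hE/and3P.
rewrite -big_seq_cond big_const_seq iter_addr_0 -[LHS]mulr_natl mulrA -natrM.
congr ((_ * _)%:R * _).
rewrite count_filter.
rewrite (eq_count (a2 := predI (predC1 (r j.-1)) (predC1 (r j.+1)))).
  (* The vertex [r j.-1] is a neighbour of [r j] exactly when [j] is positive, which gives the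
     factor [q - (0 < j)]. *)
  rewrite -count_filter (count_neighbours2 (proj1 (rr j)) rj1).
  congr (_ - nat_of_bool _)%N; case: (j) => [|i] /=; first by rewrite adjxx.
  by rewrite adjC; case: (rr i) => ->.
by move=> y /=; rewrite andbC.
Qed.

(** * Radon transforms of radial functions as sums over spheres *)

Lemma radonV_seq (C : fieldType) (f : V -> C) w n (L : seq V) :
  uniq L -> (forall v, v \notin L -> f v = 0) ->
  radonV adj v0 f w n = \sum_(v <- L | horo_index adj v v0 w == n) f v.
Proof.
move=> uL fL; rewrite bigfs//; last by move=> v _; exact: fL.
by apply: eq_fsbigl; apply/seteqP; split=> v /= /eqP.
Qed.

(** Exchange of sums: each vertex lies on exactly one horosphere. Outside the finite list [N] of
    indices met by [L] the transform vanishes. *)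
Lemma bilateral_sum_radonV (C : fieldType) (d : int -> C) (f : V -> C) w
    (L : seq V) : uniq L -> (forall v, v \notin L -> f v = 0) ->
  bilateral_sum d (radonV adj v0 f w)
    = \sum_(v <- L) f v * d (horo_index adj v v0 w).
Proof.
move=> uL fL; pose N := undup [seq horo_index adj v v0 w | v <- L].
rewrite /bilateral_sum (@fsbigTE _ _ _ _ [fset n in N]%fset); last first.
  move=> n; rewrite !inE mem_undup => nN.
  rewrite (radonV_seq _ _ uL fL) big_seq_cond big1 ?mulr0// => v.
  move=> /andP[vL /eqP hv].
  by case/mapP: nN; exists v.
rewrite (perm_big N) /=; last first.
  by apply: uniq_perm; rewrite ?fset_uniq ?undup_uniq// => n; rewrite !inE.
under eq_bigr do rewrite (radonV_seq _ _ uL fL) mulr_sumr big_mkcond.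
rewrite exchange_big /= [RHS]big_seq [LHS]big_seq; apply: eq_bigr => v vL.
rewrite (bigD1_seq (horo_index adj v v0 w)) ?undup_uniq//=; last first.
  by rewrite mem_undup; exact: map_f.
rewrite eqxx big1 ?addr0 1?mulrC// => n.
by rewrite eq_sym => /negbTE ->.
Qed.

(** [F m] is the value of [f] on the sphere of radius [m], and [M] bounds the radius of the support.
    Both are chosen before [w], so the right-hand sides do not depend on the end. *)
Lemma radial_sums (C : fieldType) (f : V -> C) :
  finitely_supported f -> radial adj v0 f ->
  exists (M : nat) (F : nat -> C), F 0%N = f v0 /\ forall w, ends adj w ->
    (forall n, radonV adj v0 f w n =
       \sum_(0 <= m < M.+1) F m * horo_sum (fun k => (k == n)%:R) 0 m) /\
    (forall d, bilateral_sum d (radonV adj v0 f w) =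
       \sum_(0 <= m < M.+1) F m * horo_sum d 0 m).
Proof.
move=> finf radf.
pose M := \max_(v <- fset_set [set x | f x != 0]) dist adj v v0.
pose F m := f (xget v0 [set v | dist adj v v0 = m]).
pose L := flatten [seq branch m v0 v0 | m <- index_iota 0 M.+1].
have FE m v : dist adj v v0 = m -> f v = F m.
  move=> dv; apply: radf.
  by rewrite dv (@xgetI _ v0 [set v | dist adj v v0 = m] v).
have dist_branch m v : v \in branch m v0 v0 -> dist adj v v0 = m.
  by move=> /branchP[p [rp <- <-]]; exact: dist_reduced_rev rp.
have uL : uniq L.
  apply: flatten_map_uniq; first exact: iota_uniq.
    by move=> m _; exact: branch_uniq.
  by move=> m n _ _ v /dist_branch <- /dist_branch.
have fL v : v \notin L -> f v = 0.
  apply: contraNeq => fv; have [p rp lp] := reduced_exists treeT v0 v.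
  apply/flattenP; exists (branch (size p) v0 v0); last first.
    by apply/branchP; exists p.
  apply: (map_f (fun m => branch m v0 v0)).
  rewrite mem_index_iota /= ltnS -(dist_reduced_rev treeT rp) lp.
  by apply: leq_bigmax_seq; rewrite // in_fset_set// inE.
have LE (d : int -> C) w : ends adj w ->
    \sum_(v <- L) f v * d (horo_index adj v v0 w) =
    \sum_(0 <= m < M.+1) F m * horo_sum d 0 m.
  move=> we; rewrite big_flatten big_map; apply: eq_bigr => m _.
  have [_ r0] := ray_fromP treeT v0 we.
  rewrite -(sum_branch _ _ _ we) /= r0 mulr_sumr.
  by apply: eq_big_seq => v /dist_branch/FE ->.
exists M, F; split; first by apply/esym/FE/(distxx treeT).
move=> w we; split=> [n|d]; last by rewrite (bilateral_sum_radonV _ _ uL fL) LE.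
rewrite (radonV_seq _ _ uL fL) -(LE _ w we) big_mkcond.
apply: eq_bigr => v _ /=.
by case: eqP; rewrite ?mulr1 ?mulr0.
Qed.

End Spheres.

(** * Closed forms of the sphere sums for the two sequences *)

Section Inversion.
Variables (C : numFieldType) (q : nat).
Hypothesis q_gt0 : (0 < q)%N.

Lemma horo_sumS (d : int -> C) j l : horo_sum q d j l.+1 =
  horo_sum q d j.+1 l + ((q - (0 < j)) * q ^ l)%:R * d (j%:Z - l.+1%:Z).
Proof. by []. Qed.

Let natr_q1 n : ((q - 1) * n)%:R = (q%:R - 1) * n%:R :> C.
Proof. by rewrite natrM natrB. Qed.

Lemma dvd2_subz j l : (2 %| j%:Z - l%:Z)%Z = ~~ odd (j + l).
Proof. lia. Qed.

Lemma dseq1_subz j l : dseq1 C q (j%:Z - l%:Z) =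
  if odd (j + l) then 0
  else if j == l then 1 else if (l < j)%N then 1 - q%:R else 0.
Proof.
rewrite /dseq1 dvd2_subz subr_eq0 subr_gt0 ltz_nat eqz_nat.
by case: (ltngtP l j) => [||->]; rewrite /= ?if_neg ?addnn ?odd_double ?if_same.
Qed.

Lemma dseq2_subz j l : dseq2 C q (j%:Z - l%:Z) =
  if odd (j + l) then 0
  else if (j <= l)%N then 1 else 1 - q%:R - q%:R ^+ (j - l).
Proof.
rewrite /dseq2 dvd2_subz subr_le0 lez_nat if_neg; case: ifP => // _.
by case: leqP => // lj; rewrite subzn 1?ltnW.
Qed.

(** The closed form starts at [j.+1], where the branching factor is constantly [q - 1]; the origin
    of the ray is treated separately. *)
Lemma horo_sum_dseq1 j l : horo_sum q (dseq1 C q) j.+1 l =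
  if odd (j.+1 + l) then 0
  else if (l <= j)%N then (1 - q%:R) * q%:R ^+ l else 0.
Proof.
elim: l j => [|l IH] j.
  by have := dseq1_subz j.+1 0; rewrite subr0 mulr1 /= => ->.
rewrite horo_sumS IH natr_q1 natrX dseq1_subz eqSS ltnS addSnnS.
case: ifPn => ev; first by rewrite mulr0 addr0.
case: (ltngtP l j) => [lj|lj|->].
- by rewrite leqW 1?ltnW// exprS; ring.
(* Parity excludes [l = j.+1]. *)
- have /negbTE -> : ~~ (l <= j.+1)%N by lia.
  by ring.
- by rewrite leqnSn; ring.
Qed.

Lemma horo_sum_dseq2 j l : horo_sum q (dseq2 C q) j.+1 l =
  if odd (j.+1 + l) then 0
  else (if (l <= j)%N then (1 - q%:R) * q%:R ^+ l + q%:R ^+ j else q%:R ^+ l)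
       - q%:R ^+ (j.+1 + l) - q%:R ^+ (j + l).
Proof.
elim: l j => [|l IH] j.
  have := dseq2_subz j.+1 0; rewrite subr0 !addn0 subn0 /= => ->.
  by case: ifP => // _; ring.
rewrite horo_sumS IH natr_q1 natrX dseq2_subz subSS ltnS addSnnS.
case: ifPn => ev; first by rewrite mulr0 addr0.
case: (ltngtP l j) => [lj|lj|->].
(* This substitution removes the truncated subtraction in the exponent [j - l], leaving a polynomial
   identity. *)
- have [k ->] : exists k, j = (l + k).+1 by exists (j - l.+1)%N; lia.
  have -> : ((l + k).+1 - l = k.+1)%N by lia.
  rewrite leqW ?leqW ?leq_addr// !addSn !addnS !exprS !exprD.
  by ring.
- have /negbTE -> : ~~ (l <= j.+1)%N by lia.
  by rewrite !addnS !exprS; ring.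
- by rewrite leqnSn !addSn !addnS !exprS !exprD; ring.
Qed.

(** For positive [m], walks leaving at [v0] reach a negative index, where [dseq1] is 0; the closed
    form for the other walks vanishes by parity or because [l] exceeds [j = 0]. *)
Lemma horo_sum0_dseq1 m : horo_sum q (dseq1 C q) 0 m = (m == 0%N)%:R.
Proof.
case: m => [|m] //; rewrite horo_sumS horo_sum_dseq1 dseq1_subz /= !add0n.
by case: m => [|m] /=; rewrite ?if_same mulr0 addr0 ?if_same.
Qed.

(** For even positive [m], walks leaving at [v0] contribute [q ^ m], and the closed form for the
    remaining ones is [- q ^ m]. *)
Lemma horo_sum0_dseq2 m : horo_sum q (dseq2 C q) 0 m = (m == 0%N)%:R.
Proof.
case: m => [|m] //; rewrite horo_sumS horo_sum_dseq2 dseq2_subz /= !add0n subn0.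
case: m => [|m] //=; first by rewrite mulr0 addr0.
case: ifP => _; first by rewrite mulr0 addr0.
by rewrite natrM natrX add1n !exprS; ring.
Qed.

Lemma horo_sum_affine (t : C) (d d' : int -> C) j l :
  horo_sum q (fun n => d n + t * (d' n - d n)) j l =
  horo_sum q d j l + t * (horo_sum q d' j l - horo_sum q d j l).
Proof. by elim: l j => //= l IH j; rewrite IH; ring. Qed.

End Inversion.

(** * From sphere sums to uncountably many inversion formulas *)

Lemma inversion_sequence_horo_sum (C : fieldType) (V : choiceType) (adj : rel V)
    (q : nat) (v0 : V) (d : int -> C) : homogeneous_tree q adj ->
  (forall m, horo_sum q d 0 m = (m == 0%N)%:R) -> inversion_sequence adj v0 d.
Proof.
move=> homT dE f finf radf w we.
have [M [F [F0 FE]]] := radial_sums homT finf radf.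
have [_ ->] := FE w we; rewrite big_nat_recl// dE mulr1 F0 big1 ?addr0// => m _.
by rewrite dE mulr0.
Qed.

(** A countable set has Lebesgue measure 0, but the open unit interval has measure 1. *)
Lemma real_uncountable (R : realType) : ~ countable [set: R].
Proof.
move=> cR; have c01 : countable [set` `](0 : R), (1 : R)[ ].
  by apply: sub_countable cR; exact: subset_card_le.
have := countable_lebesgue_measure0 c01.
rewrite lebesgue_measure_itv /= lte_fin ltr01 oppr0 adde0 => /eqP.
by rewrite eqe oner_eq0.
Qed.

Unset Implicit Arguments.

Theorem theorem3p2p1 (R : realType) (q : nat) (V : choiceType) (adj : rel V)
    (v0 : V) (hq : (1 <= q)%N) (hT : homogeneous_tree q adj) :
  (forall f : V -> R[i], finitely_supported f -> radial adj v0 f ->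
     forall w w', ends adj w -> ends adj w' ->
     forall n : int, radonV adj v0 f w n = radonV adj v0 f w' n)
  /\ ~ countable [set d : int -> R[i] | inversion_sequence adj v0 d]
  /\ (forall d d' : int -> R[i],
        inversion_sequence adj v0 d -> inversion_sequence adj v0 d' ->
        forall f : V -> R[i], finitely_supported f -> radial adj v0 f ->
        forall w, ends adj w ->
        bilateral_sum d (radonV adj v0 f w) =
        bilateral_sum d' (radonV adj v0 f w))
  /\ inversion_sequence adj v0 (dseq1 R[i] q)
  /\ inversion_sequence adj v0 (dseq2 R[i] q)
  /\ dseq1 R[i] q <> dseq2 R[i] q.
Proof.
(* At the negative even index -2 the first sequence is 0 and the second is 1, whatever [q] is. *)
have dseq_neq : dseq1 R[i] q (-2) != dseq2 R[i] q (-2).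
  by rewrite /dseq1 /dseq2 /= eq_sym oner_eq0.
have inv d := @inversion_sequence_horo_sum R[i] V adj q v0 d hT.
have sum1 := horo_sum0_dseq1 R[i] hq; have sum2 := horo_sum0_dseq2 R[i] hq.
split=> [f finf radf w w' we we' n|].
  have [M [F [_ FE]]] := radial_sums hT finf radf.
  by rewrite (FE w we).1 (FE w' we').1.
split; last split; last split; last split.
- move=> /countable_injP[g ginj]; apply: (@real_uncountable R).
  (* The real affine line through the two sequences. *)
  pose D (t : R) (n : int) : R[i] :=
    dseq1 R[i] q n + t%:C * (dseq2 R[i] q n - dseq1 R[i] q n).
  have invD t : inversion_sequence adj v0 (D t).
    by apply: inv => m; rewrite horo_sum_affine sum1 sum2 subrr mulr0 addr0.
  (* The entry at -2 determines [t], so an injection [g] of the inversion sequences into the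
     naturals would yield one of the reals. *)
  apply/countable_injP; exists (g \o D) => t u _ _ /= /ginj.
  rewrite !inE => /(_ (invD t) (invD u)) /(congr1 (@^~ (-2))) /addrI.
  by move/mulIf; rewrite subr_eq0 eq_sym => /(_ dseq_neq) [].
- by move=> d d' dinv d'inv f finf radf w we; rewrite -dinv// -d'inv.
- exact: inv.
- exact: inv.
- by move=> e; rewrite e eqxx in dseq_neq.
Qed.
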